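(* Consider the FlexFL algorithm run with the online control algorithm (both defined in the context) with constants $V>0$ and initial queue length $W\ge 0$ for $T\ge1$ iterations. Assume that for some $D>0$ and $B>0$, for all $t\in\{0,\dots,T-1\}$ and $n\in\{1,\dots,N\}$: (i) $q_t^n\in[\frac1D,1]$ (this is the feasible set for $q_t^n$); (ii) $\|\mathbf{b}_t^n\|^2\in[0,D]$ and $\|\mathbf{a}_t\|^2\in[0,D]$; (iii) the costs $\lambda_t^n,\varphi_t^n,\psi_t$ and the targets $\tilde\lambda_n,\tilde\varphi_n,\tilde\psi$ all lie in $[0,\sqrt{2B}]$; (iv) $\tilde\lambda_n\ge\lambda_t^n(\frac1D)$; (v) $\varphi_t^n(\mathbf{0})=\psi_t(\mathbf{0})=0$. Let $q_t^n,\mathbf{v}_t^n,\mathbf{u}_t$ be optimal solutions of the per-iteration problems P3.1, P3.2, P3.3 for each $t$ (and $n$), and let $\lambda_t^n=\lambda_t^n(q_t^n)$, $\varphi_t^n=\varphi_t^n(\mathbf{v}_t^n)$, $\psi_t=\psi_t(\mathbf{u}_t)$ be the corresponding costs. Then, for all $n$, $$\frac1T\sum_{t=0}^{T-1}\mathbb{E}[\lambda_t^n]-\tilde\lambda_n\le\sqrt{\frac{W^2}{T^2}+\frac{2VD+2B}{T}}-\frac{W}{T},$$ $$\frac1T\sum_{t=0}^{T-1}\mathbb{E}[\varphi_t^n]-\tilde\varphi_n\le\sqrt{\frac{W^2}{T^2}+\frac{2VD+2B}{T}}-\frac{W}{T},$$ $$\frac1T\sum_{t=0}^{T-1}\ma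thbb{E}[\psi_t]-\tilde\psi\le\sqrt{\frac{W^2}{T^2}+\frac{2VD+2B}{T}}-\frac{W}{T}.$$
   Context: All norms are Euclidean. There are $N$ clients and one server. For each iteration $t$ there are (possibly random, time-varying) cost functions: computation cost $\lambda_t^n(\cdot)$ of $q_t^n$ and communication cost $\varphi_t^n(\cdot)$ of $\mathbf{v}_t^n\in\mathbb{R}^d$ for each client $n$, and communication cost $\psi_t(\cdot)$ of $\mathbf{u}_t\in\mathbb{R}^d$ for the server. The targets $\tilde\lambda_n,\tilde\varphi_n,\tilde\psi$ are given constants. FlexFL with online control: given a learning rate $\eta>0$, stochastic gradients $\mathbf{g}_n$ (random vector-valued functions on $\mathbb{R}^d$) and an initial $\mathbf{x}_0\in\mathbb{R}^d$, set $\mathbf{r}_0=\mathbf{0}$, $\mathbf{e}_0^n=\mathbf{0}$, and virtual queue lengths $\Lambda_0^n=\Phi_0^n=\Psi_0=W$ for all $n$. For $t=0,\dots,T-1$: 1. Each client $n$ obtains $q_t^n$ as a solution of P3.1: $\min_{q}\ \frac{V}{q}+\Lambda_t^n(\lambda_t^n(q)-\tilde\lambda_n)$ over $q\in[\frac1D,1]$; updates $\Lambda_{t+1}^n=\max\{0,\Lambda_t^n+\lambda_t^n(q_t^n)-\tilde\lambda_n\}$; samples $\mathbb{I}_t^n\sim\mathrm{Bernoulli}(q_t^n)$; sets $\mathbf{b}_t^n=\mathbf{e}_t^n-\frac{\eta\,\mathbb{I}_t^n}{q_t^n}\mathbf{g}_n(\mathbf{x}_t)$; obtains $\mathbf{v}_t^n$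 as a solution of P3.2: $\min_{\mathbf{v}\in\mathbb{R}^d}\ V\|\mathbf{b}_t^n-\mathbf{v}\|^2+\Phi_t^n(\varphi_t^n(\mathbf{v})-\tilde\varphi_n)$; updates $\Phi_{t+1}^n=\max\{0,\Phi_t^n+\varphi_t^n(\mathbf{v}_t^n)-\tilde\varphi_n\}$; sets $\mathbf{e}_{t+1}^n=\mathbf{b}_t^n-\mathbf{v}_t^n$. 2. The server sets $\mathbf{a}_t=\mathbf{r}_t+\frac1N\sum_{n=1}^N\mathbf{v}_t^n$; obtains $\mathbf{u}_t$ as a solution of P3.3: $\min_{\mathbf{u}\in\mathbb{R}^d}\ V\|\mathbf{a}_t-\mathbf{u}\|^2+\Psi_t(\psi_t(\mathbf{u})-\tilde\psi)$; updates $\Psi_{t+1}=\max\{0,\Psi_t+\psi_t(\mathbf{u}_t)-\tilde\psi\}$; sets $\mathbf{r}_{t+1}=\mathbf{a}_t-\mathbf{u}_t$. 3. $\mathbf{x}_{t+1}=\mathbf{x}_t+\mathbf{u}_t$. It is presumed that minimizers of P3.1--P3.3 exist. The bounds assumed in (i)--(v) hold for every realization (almost surely); in (iii) the cost functions take values in $[0,\sqrt{2B}]$ at all admissible inputs. *)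

(* Defs.v *)
(* MathComp / MathComp-Analysis *)
From HB Require Import structures.
From mathcomp Require Import all_boot all_order all_algebra.
From mathcomp Require Import all_classical all_reals all_analysis.

Set Implicit Arguments.
Unset Strict Implicit.
Unset Printing Implicit Defensive.

Import Order.TTheory GRing.Theory Num.Theory.
Import numFieldNormedType.Exports.

Local Open Scope classical_set_scope.
Local Open Scope ring_scope.

(* The canonical norm of the library on row vectors is the max norm, hence this
   separate Euclidean norm. *)
Definition enorm (R : realType) (d : nat) (v : 'rV[R]_d) : R :=
  Num.sqrt (\sum_(i < d) v 0 i ^+ 2).

Definition is_minimizer (R : realType) (X : Type) (A : set X) (f : X -> R)
    (x : X) : Prop :=
  A x /\ forall y, A y -> f x <= f y.

(* The records below describe one realization; the random objects are functions
   from the sample space to them. Time is the nat argument, and clients are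
   indexed by 'I_N. *)
Record costs (R : realType) (N d : nat) := Costs {
  comp_cost : nat -> 'I_N -> R -> R ;           (* lambda_t^n *)
  up_cost : nat -> 'I_N -> 'rV[R]_d -> R ;      (* phi_t^n *)
  down_cost : nat -> 'rV[R]_d -> R }.           (* psi_t *)

Record targets (R : realType) (N : nat) := Targets {
  comp_target : 'I_N -> R ;
  up_target : 'I_N -> R ;
  down_target : R }.

Record trajectory (R : realType) (N d : nat) := Trajectory {
  q_ : nat -> 'I_N -> R ;
  I_ : nat -> 'I_N -> bool ;
  b_ : nat -> 'I_N -> 'rV[R]_d ;
  v_ : nat -> 'I_N -> 'rV[R]_d ;
  e_ : nat -> 'I_N -> 'rV[R]_d ;
  a_ : nat -> 'rV[R]_d ;
  u_ : nat -> 'rV[R]_d ;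
  r_ : nat -> 'rV[R]_d ;
  x_ : nat -> 'rV[R]_d ;
  Lambda : nat -> 'I_N -> R ;
  Phi : nat -> 'I_N -> R ;
  Psi : nat -> R }.

(* g t n is the realization of the stochastic gradient g_n drawn at time t.
   The sampling law of I_ is a property of the random trajectory, not of a
   single realization; see conditionally_bernoulli. *)
Record flexfl_path (R : realType) (N d T : nat) (eta V W D : R)
    (x0 : 'rV[R]_d) (tgt : targets R N) (c : costs R N d)
    (g : nat -> 'I_N -> 'rV[R]_d -> 'rV[R]_d) (z : trajectory R N d) : Prop :=
  FlexflPath {
  init_x : x_ z 0%N = x0 ;
  init_r : r_ z 0%N = 0 ;
  init_e : forall n, e_ z 0%N n = 0 ;
  init_Lambda : forall n, Lambda z 0%N n = W ;
  init_Phi : forall n, Phi z 0%N n = W ;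
  init_Psi : Psi z 0%N = W ;
  q_opt : forall t n, (t < T)%N ->
    is_minimizer [set p : R | D^-1 <= p <= 1]
      (fun p => V / p + Lambda z t n * (comp_cost c t n p - comp_target tgt n))
      (q_ z t n) ;
  Lambda_step : forall t n, (t < T)%N ->
    Lambda z t.+1 n =
      Num.max 0 (Lambda z t n + comp_cost c t n (q_ z t n) - comp_target tgt n) ;
  b_def : forall t n, (t < T)%N ->
    b_ z t n = e_ z t n - (eta * (I_ z t n)%:R / q_ z t n) *: g t n (x_ z t) ;
  v_opt : forall t n, (t < T)%N ->
    is_minimizer setT
      (fun y => V * enorm (b_ z t n - y) ^+ 2
                + Phi z t n * (up_cost c t n y - up_target tgt n))
      (v_ z t n) ;
  Phi_step : forall t n, (t < T)%N ->
    Phi z t.+1 n =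
      Num.max 0 (Phi z t n + up_cost c t n (v_ z t n) - up_target tgt n) ;
  e_step : forall t n, (t < T)%N -> e_ z t.+1 n = b_ z t n - v_ z t n ;
  a_def : forall t, (t < T)%N ->
    a_ z t = r_ z t + N%:R^-1 *: \sum_(n < N) v_ z t n ;
  u_opt : forall t, (t < T)%N ->
    is_minimizer setT
      (fun y => V * enorm (a_ z t - y) ^+ 2
                + Psi z t * (down_cost c t y - down_target tgt))
      (u_ z t) ;
  Psi_step : forall t, (t < T)%N ->
    Psi z t.+1 = Num.max 0 (Psi z t + down_cost c t (u_ z t) - down_target tgt) ;
  r_step : forall t, (t < T)%N -> r_ z t.+1 = a_ z t - u_ z t ;
  x_step : forall t, (t < T)%N -> x_ z t.+1 = x_ z t + u_ z t }.

(* I ~ Bernoulli(p) for a random parameter p: the conditional law of I given p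
   is bernoulli_prob p. *)
Definition conditionally_bernoulli (disp : measure_display)
    (Omega : measurableType disp) (R : realType) (P : probability Omega R)
    (p : Omega -> R) (I : Omega -> bool) : Prop :=
  [/\ measurable_fun setT p, measurable_fun setT I &
    forall (A : set R) (S : set bool), measurable A ->
      P (p @^-1` A `&` I @^-1` S)
        = (\int[P]_(w in p @^-1` A) bernoulli_prob (p w) S)%E].

(* Random version: z follows the updates in every realization, its participation
   indicators have the prescribed law, and the incurred costs are random
   variables. *)
Record flexfl_online (disp : measure_display) (Omega : measurableType disp)
    (R : realType) (P : probability Omega R) (N d T : nat) (eta V W D : R)
    (x0 : 'rV[R]_d) (tgt : targets R N) (c : Omega -> costs R N d)
    (g : Omega -> nat -> 'I_N -> 'rV[R]_d -> 'rV[R]_d)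
    (z : Omega -> trajectory R N d) : Prop := FlexflOnline {
  online_path : forall w, flexfl_path T eta V W D x0 tgt (c w) (g w) (z w) ;
  online_sampling : forall t n, (t < T)%N ->
    conditionally_bernoulli P (fun w => q_ (z w) t n) (fun w => I_ (z w) t n) ;
  measurable_comp_cost : forall t n, (t < T)%N ->
    measurable_fun setT (fun w => comp_cost (c w) t n (q_ (z w) t n)) ;
  measurable_up_cost : forall t n, (t < T)%N ->
    measurable_fun setT (fun w => up_cost (c w) t n (v_ (z w) t n)) ;
  measurable_down_cost : forall t, (t < T)%N ->
    measurable_fun setT (fun w => down_cost (c w) t (u_ (z w) t)) }.

(* Main.v *)
(* Drift argument on one realization. Comparing the minimizer with the candidate
   q = 1/D (resp. v = 0, u = 0), whose penalty is at most V D and whose excess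
   cost over the target is nonpositive, gives Q_t (c_t - target) <= V D for each
   virtual queue Q_t. As |c_t - target| <= sqrt (2 B), squaring the update yields
   Q_(t+1)^2 <= Q_t^2 + 2 V D + 2 B, hence Q_T <= sqrt (W^2 + T (2 V D + 2 B)).
   Since Q_T >= W + sum_t (c_t - target), the bound holds almost surely, and the
   theorem follows by taking expectations. *)
Require Import Defs.
From HB Require Import structures.
From mathcomp Require Import all_boot all_order all_algebra.
From mathcomp Require Import all_classical all_reals all_analysis.
From mathcomp Require Import measurable_realfun ring lra.

Set Implicit Arguments.
Unset Strict Implicit.
Unset Printing Implicit Defensive.

Import Order.TTheory GRing.Theory Num.Theory.
Import numFieldNormedType.Exports.

Local Open Scope classical_set_scope.
Local Open Scope ring_scope.

(** Truncation at 0 acts favourably twice: it only raises the queue, so [Q T] dominates [W] plus the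
    increments, and it never enlarges the square, so [Q ^+ 2] gains at most [K] per step. One
    induction carries both facts. *)
Lemma queue_excess_le (R : realType) (T : nat) (W K : R) (Q y : nat -> R) :
  Q 0%N = W ->
  (forall t, (t < T)%N -> Q t.+1 = Num.max 0 (Q t + y t)) ->
  (forall t, (t < T)%N -> 2 * (Q t * y t) + y t ^+ 2 <= K) ->
  \sum_(t < T) y t <= Num.sqrt (W ^+ 2 + T%:R * K) - W.
Proof.
move=> Q0 Qstep drift.
suff [sumQ QT] : W + \sum_(t < T) y t <= Q T /\ Q T ^+ 2 <= W ^+ 2 + T%:R * K.
  rewrite lerBrDl (le_trans sumQ)// (le_trans (ler_norm _))//.
  by rewrite -sqrtr_sqr ler_wsqrtr.
elim: T Qstep drift => [|T IH] Qstep drift.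
  by rewrite big_ord0 Q0; split; lra.
have [sumQ QT] := IH (fun t tT => Qstep t (leqW tT))
  (fun t tT => drift t (leqW tT)).
rewrite big_ord_recr /= Qstep//; have := drift T (ltnSn T).
have sqD : (Q T + y T) ^+ 2 = Q T ^+ 2 + (2 * (Q T * y T) + y T ^+ 2) by lra.
rewrite -natr1 => drT; split; first by rewrite le_max; apply/orP; right; lra.
(* When the untruncated value is negative, the left side is 0 and the right side is still a
   square. *)
suff : Num.max 0 (Q T + y T) ^+ 2 <= (Q T + y T) ^+ 2 by lra.
by case: (leP 0 (Q T + y T)) => // _; rewrite expr0n sqr_ge0.
Qed.

(** Integrability is never assumed: almost sure nonnegativity allows the sum and the integral to be
    exchanged in the extended reals. *)
Lemma sum_expectation_le (disp : measure_display) (Omega : measurableType disp)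
    (R : realType) (P : probability Omega R) (T : nat)
    (X : nat -> Omega -> R) (S : R) :
  (forall t, (t < T)%N -> measurable_fun setT (X t)) ->
  (forall t, (t < T)%N -> {ae P, forall w, 0 <= X t w}) ->
  {ae P, forall w, \sum_(t < T) X t w <= S} ->
  (\sum_(t < T) 'E_P[X t] <= S%:E)%E.
Proof.
move=> mX X_ge0 X_le.
(* The positive part agrees with [X t] almost surely and is nonnegative at every point, as
   additivity of the nonnegative integral requires. *)
pose Y (t : 'I_T) (w : Omega) : \bar R := ((X t)^\+ w)%:E.
have mY (t : 'I_T) : measurable_fun setT (Y t).
  by apply/measurable_EFinP; exact: measurable_funrpos (mX _ _).
have {}X_ge0 : {ae P, forall w, forall t, (t < T)%N -> 0 <= X t w}.
  apply/ae_foralln => t; case: (ltnP t T) => tT; last exact: aeW.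
  by apply: filterS (X_ge0 t tT).
have EY (t : 'I_T) : ('E_P[X t] = \int[P]_w Y t w)%E.
  rewrite unlock; apply: ae_eq_integral => //.
    by apply/measurable_EFinP; exact: mX.
  apply: filterS X_ge0 => w + _ => /(_ t (ltn_ord t)) Xw /=.
  by rewrite /funrpos; congr EFin; apply/esym/max_idPl.
rewrite (eq_bigr _ (fun t _ => EY t)) -ge0_integral_sum//; last first.
  by move=> t w _; rewrite lee_fin funrpos_ge0.
(* Comparison with the constant [S] needs a nonnegative integrand. As [P] has mass 1, the almost
   sure properties share a sample point, and the sign of [S] is read off there. *)
have S_ge0 : 0 <= S.
  have [w [Xw Sw]] : exists w, (forall t, (t < T)%N -> 0 <= X t w)
      /\ \sum_(t < T) X t w <= S.
    have P_proper : ProperFilter (almost_everywhere P).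
      apply: ae_properfilter_algebraOfSetsType.
      have : (0 < P setT)%E by rewrite probability_setT.
      exact.
    exact: filter_ex (filterI X_ge0 X_le).
  by apply: le_trans Sw; apply: sumr_ge0 => t _; exact: Xw.
apply: (@le_trans _ _ (\int[P]_w (cst S%:E w))%E); last first.
  by rewrite integral_cst//= probability_setT mule1.
apply: ae_ge0_le_integral => //.
- by move=> w _; apply: sume_ge0 => t _; rewrite lee_fin funrpos_ge0.
- exact: emeasurable_sum.
- apply: filterS2 X_ge0 X_le => w Xw Sw _.
  rewrite sumEFin lee_fin /=; apply: le_trans Sw.
  by apply: ler_sum => t _; rewrite /funrpos ge_max lexx Xw.
Qed.

(** Common form of the three claims, with [A] standing for the bound on queue times excess. The
    drift hypothesis may presuppose [0 <= Q t w], since this sign follows from [W_ge0] and the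
    truncated update. *)
Lemma expected_excess_le (disp : measure_display) (Omega : measurableType disp)
    (R : realType) (P : probability Omega R) (T : nat) (W A B tau : R)
    (X Q : nat -> Omega -> R) :
  (0 < T)%N -> 0 <= B -> 0 <= tau <= Num.sqrt (2 * B) ->
  (forall t, (t < T)%N -> measurable_fun setT (X t)) ->
  (forall w, Q 0%N w = W) ->
  (forall t w, (t < T)%N -> Q t.+1 w = Num.max 0 (Q t w + X t w - tau)) ->
  (forall t, (t < T)%N -> {ae P, forall w, 0 <= X t w <= Num.sqrt (2 * B)}) ->
  (forall t, (t < T)%N ->
    {ae P, forall w, 0 <= Q t w -> Q t w * (X t w - tau) <= A}) ->
  0 <= W ->
  ((T%:R^-1)%:E * \sum_(t < T) 'E_P[X t] - tau%:E
    <= (Num.sqrt (W ^+ 2 / T%:R ^+ 2 + (2 * A + 2 * B) / T%:R) - W / T%:R)%:E)%E.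
Proof.
move=> T_gt0 B_ge0 /andP[tau_ge0 tau_le] mX Q0 Qstep X_bound drift W_ge0.
have T0 : 0 < T%:R :> R by rewrite ltr0n.
set K := 2 * A + 2 * B.
have Q_ge0 w t : (t <= T)%N -> 0 <= Q t w.
  by case: t => [|t] tT; rewrite ?Q0// Qstep// le_max lexx.
have sumX_le : {ae P, forall w,
    \sum_(t < T) X t w <= Num.sqrt (W ^+ 2 + T%:R * K) - W + T%:R * tau}.
  have : {ae P, forall w, forall t, (t < T)%N ->
      2 * (Q t w * (X t w - tau)) + (X t w - tau) ^+ 2 <= K}.
    apply/ae_foralln => t; case: (ltnP t T) => tT; last exact: aeW.
    apply: filterS2 (X_bound t tT) (drift t tT).
    move=> w /andP[X0 XB] /(_ (Q_ge0 w t (ltnW tT))) QX _.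
    (* Cost and target lie in the same interval of length [Num.sqrt (2 * B)], so their difference is
       at most that length in absolute value. *)
    have : (X t w - tau) ^+ 2 <= Num.sqrt (2 * B) ^+ 2.
      rewrite -real_normK ?num_real//.
      by rewrite lerXn2r ?nnegrE ?sqrtr_ge0// ler_norml; lra.
    by rewrite sqr_sqrtr ?mulr_ge0//; rewrite /K; lra.
  apply: filterS => w Kw.
  rewrite -lerBlDr -[T%:R * tau](_ : \sum_(t < T) tau = _); last first.
    by rewrite sumr_const card_ord mulr_natl.
  rewrite -sumrB.
  apply: (@queue_excess_le R T W K (Q^~ w) (fun t => X t w - tau)) => // t tT.
  by rewrite Qstep// addrA.
have X_ge0 t : (t < T)%N -> {ae P, forall w, 0 <= X t w}.
  by move=> /X_bound; apply: filterS => w /andP[].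
have /(lee_wpmul2l (x := (T%:R^-1)%:E)) := sum_expectation_le mX X_ge0 sumX_le.
rewrite lee_fin invr_ge0 ler0n => /(_ isT) E_le.
rewrite leeBlDr// (le_trans E_le)// -EFinM -EFinD lee_fin.
(* Pulling the square of [T%:R^-1] out of the root turns the target bound into the pathwise bound
   divided by [T]. *)
have -> : W ^+ 2 / T%:R ^+ 2 + K / T%:R = (W ^+ 2 + T%:R * K) * T%:R^-1 ^+ 2.
  by field; rewrite gt_eqF.
rewrite [X in _ <= X - _ + _](_ : _ = Num.sqrt (W ^+ 2 + T%:R * K) / T%:R).
  by rewrite le_eqVlt; apply/orP; left; apply/eqP; field; rewrite gt_eqF.
rewrite [X in Num.sqrt X]mulrC sqrtrM ?sqr_ge0// sqrtr_sqr.
by rewrite ger0_norm ?invr_ge0 ?ltW// mulrC.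
Qed.

(** At the competitor [y] the objective is at most [A], because its queue term is nonpositive; at
    the minimizer [x], dropping the nonnegative penalty leaves the queue term. *)
Lemma minimizer_drift_le (R : realType) (X : Type) (S : set X)
    (pen cost : X -> R) (Q tau A : R) (x y : X) :
  is_minimizer S (fun p => pen p + Q * (cost p - tau)) x ->
  S y -> 0 <= pen x -> pen y <= A -> 0 <= Q -> cost y <= tau ->
  Q * (cost x - tau) <= A.
Proof.
move=> [_ /(_ y)] + Sy penx peny Q0 costy => /(_ Sy) opt.
have : Q * (cost y - tau) <= 0 by rewrite mulr_ge0_le0// subr_le0.
by lra.
Qed.

Theorem theorem2 (disp : measure_display) (Omega : measurableType disp)
    (R : realType) (P : probability Omega R) (N d T : nat)
    (eta V W D B : R) (x0 : 'rV[R]_d) (tgt : targets R N)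
    (c : Omega -> costs R N d)
    (g : Omega -> nat -> 'I_N -> 'rV[R]_d -> 'rV[R]_d)
    (z : Omega -> trajectory R N d)
    (T_ge1 : (1 <= T)%N) (eta_gt0 : 0 < eta) (V_gt0 : 0 < V) (W_ge0 : 0 <= W)
    (D_gt0 : 0 < D) (B_gt0 : 0 < B)
    (run : flexfl_online P T eta V W D x0 tgt c g z)
    (q_bound : forall t n, (t < T)%N ->
      {ae P, forall w, D^-1 <= q_ (z w) t n <= 1})
    (b_bound : forall t n, (t < T)%N ->
      {ae P, forall w, 0 <= enorm (b_ (z w) t n) ^+ 2 <= D})
    (a_bound : forall t, (t < T)%N ->
      {ae P, forall w, 0 <= enorm (a_ (z w) t) ^+ 2 <= D})
    (comp_cost_bound : forall t n, (t < T)%N ->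
      {ae P, forall w, forall p : R, D^-1 <= p <= 1 ->
        0 <= comp_cost (c w) t n p <= Num.sqrt (2 * B)})
    (up_cost_bound : forall t n, (t < T)%N ->
      {ae P, forall w, forall y : 'rV[R]_d,
        0 <= up_cost (c w) t n y <= Num.sqrt (2 * B)})
    (down_cost_bound : forall t, (t < T)%N ->
      {ae P, forall w, forall y : 'rV[R]_d,
        0 <= down_cost (c w) t y <= Num.sqrt (2 * B)})
    (comp_target_bound : forall n, 0 <= comp_target tgt n <= Num.sqrt (2 * B))
    (up_target_bound : forall n, 0 <= up_target tgt n <= Num.sqrt (2 * B))
    (down_target_bound : 0 <= down_target tgt <= Num.sqrt (2 * B))
    (comp_feasible : forall t n, (t < T)%N ->
      {ae P, forall w, comp_cost (c w) t n D^-1 <= comp_target tgt n})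
    (up_cost0 : forall t n, (t < T)%N ->
      {ae P, forall w, up_cost (c w) t n 0 = 0})
    (down_cost0 : forall t, (t < T)%N ->
      {ae P, forall w, down_cost (c w) t 0 = 0}) :
  forall n : 'I_N,
  [/\ ((T%:R^-1)%:E
         * \sum_(t < T) 'E_P[fun w => comp_cost (c w) t n (q_ (z w) t n)]
         - (comp_target tgt n)%:E
       <= (Num.sqrt (W ^+ 2 / T%:R ^+ 2 + (2 * V * D + 2 * B) / T%:R)
           - W / T%:R)%:E)%E,
      ((T%:R^-1)%:E
         * \sum_(t < T) 'E_P[fun w => up_cost (c w) t n (v_ (z w) t n)]
         - (up_target tgt n)%:E
       <= (Num.sqrt (W ^+ 2 / T%:R ^+ 2 + (2 * V * D + 2 * B) / T%:R)
           - W / T%:R)%:E)%E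
    & ((T%:R^-1)%:E
         * \sum_(t < T) 'E_P[fun w => down_cost (c w) t (u_ (z w) t)]
         - (down_target tgt)%:E
       <= (Num.sqrt (W ^+ 2 / T%:R ^+ 2 + (2 * V * D + 2 * B) / T%:R)
           - W / T%:R)%:E)%E].
Proof.
case: run => path _ m_comp m_up m_down.
have B0 := ltW B_gt0.
have Dv0 : 0 < D^-1 by rewrite invr_gt0.
have AE : 2 * V * D = 2 * (V * D) by rewrite mulrA.
rewrite AE => n; split.
- apply: (@expected_excess_le _ _ _ _ _ _ _ _ _
    (fun t w => comp_cost (c w) t n (q_ (z w) t n)) (fun t w => Lambda (z w) t n)) => //.
  + by move=> t; exact: m_comp.
  + by move=> w; rewrite (init_Lambda (path w)).
  + by move=> t w tT; rewrite (Lambda_step (path w)).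
  (* The cost bound covers only feasible arguments; feasibility of [q_] is part of its being a
     minimizer. *)
  + move=> t tT; apply: filterS (comp_cost_bound t n tT) => w; apply.
    by have [] := q_opt (path w) n tT.
  + move=> t tT; apply: filterS (comp_feasible t n tT) => w feas Q0.
    have opt := q_opt (path w) n tT; have [/= /andP[Dq q1] _] := opt.
    (* The competitor [D^-1] has penalty exactly [V * D]. It is feasible because [D^-1 <= q_ <= 1]
       forces [D^-1 <= 1]. *)
    apply: (minimizer_drift_le opt (y := D^-1)) => //=.
    * by rewrite lexx (le_trans Dq).
    * by rewrite divr_ge0 ?ltW// (lt_le_trans Dv0).
    * by rewrite invrK.
- apply: (@expected_excess_le _ _ _ _ _ _ _ _ _
    (fun t w => up_cost (c w) t n (v_ (z w) t n)) (fun t w => Phi (z w) t n)) => //.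
  + by move=> t; exact: m_up.
  + by move=> w; rewrite (init_Phi (path w)).
  + by move=> t w tT; rewrite (Phi_step (path w)).
  + by move=> t tT; apply: filterS (up_cost_bound t n tT) => w; apply.
  + move=> t tT; apply: filterS2 (up_cost0 t n tT) (b_bound t n tT).
    move=> w cost0 /andP[_ bD] Q0.
    (* Sending nothing costs 0, hence stays within the target, and its penalty
       [V * enorm (b_ (z w) t n) ^+ 2] is at most [V * D]. *)
    apply: (minimizer_drift_le (v_opt (path w) n tT) (y := 0)) => //=.
    * by rewrite mulr_ge0 ?sqr_ge0// ltW.
    * by rewrite subr0 ler_pM2l.
    * by rewrite cost0; have /andP[] := up_target_bound n.
- apply: (@expected_excess_le _ _ _ _ _ _ _ _ _
    (fun t w => down_cost (c w) t (u_ (z w) t)) (fun t w => Psi (z w) t)) => //.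
  + by move=> w; rewrite (init_Psi (path w)).
  + by move=> t w tT; rewrite (Psi_step (path w)).
  + by move=> t tT; apply: filterS (down_cost_bound t tT) => w; apply.
  + move=> t tT; apply: filterS2 (down_cost0 t tT) (a_bound t tT).
    move=> w cost0 /andP[_ aD] Q0.
    apply: (minimizer_drift_le (u_opt (path w) tT) (y := 0)) => //=.
    * by rewrite mulr_ge0 ?sqr_ge0// ltW.
    * by rewrite subr0 ler_pM2l.
    * by rewrite cost0; have /andP[] := down_target_bound.
Qed.
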